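(* Let $S$ be a set, let $G,H \leq \mathrm{Sym}(S)$ be dual groups, let $G_0$ be a subgroup of $G$, and let $s_0$ be an element of $S$. Let $S_0 = G_0 s_0$ be the orbit of $s_0$ under the action of $G_0$. Then the following hold. \begin{enumerate} \item The group $G_0$ acts simply transitively on $S_0$. \item If $g \in G$ and $g s_0 \in S_0$, then $g \in G_0$. In particular, if $g \in G$ and $g s_0 \in S_0$, then $g$ preserves $S_0$ as a set, that is, $g(S_0) \subseteq S_0$. \item Let $H_0 = \{h \in H : h s_0 \in S_0\}$. Then $H_0$ is a subgroup of $H$, and $H_0$ acts simply transitively on $S_0$. \item Restriction from $S$ to $S_0$ embeds $G_0$ and $H_0$ in $\mathrm{Sym}(S_0)$ (i.e. $g \mapsto g|_{S_0}$ defines injective group homomorphisms $G_0 \to \mathrm{Sym}(S_0)$ and $H_0 \to \mathrm{Sym}(S_0)$). Denote their images in $\mathrm{Sym}(S_0)$ by $G_0|_{S_0}$ and $H_0|_{S_0}$. \item If $g \in \mathrm{Sym}(S_0)$ commutes with every element of $H_0|_{S_0}$, then $g$ admits a unique extension to $S$ which belongs to $G$, and this extension belongs to $G_0$. Similarly, if $h \in \mathrm{Sym}(S_0)$ commutes with every element of $G_0|_{S_0}$, then $h$ admits a unique extension to $S$ which belongs to $H$, and this extension belongs to $H_0$. \item The groups $G_0|_{S_0}$ and $H_0|_{S_0}$ are dual in $\mathrm{Sym}(S_0)$. \end{enumerate}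
   Context: $\mathrm{Sym}(S)$ denotes the symmetric group of all bijections $S \to S$. An action on a nonempty set is simply transitive if for any two points $x,y$ there is exactly one group element $g$ with $gx=y$. Two subgroups $G$ and $H$ of $\mathrm{Sym}(S)$ are called dual if their natural actions on $S$ are both simply transitive and each is the centralizer of the other in $\mathrm{Sym}(S)$, that is, $C_{\mathrm{Sym}(S)}(G)=H$ and $C_{\mathrm{Sym}(S)}(H)=G$. *)

(* Defs.v *)
From HB Require Import structures.
From mathcomp Require Import all_boot.
From mathcomp Require Import boolp classical_sets functions.

Set Implicit Arguments.
Unset Strict Implicit.
Unset Printing Implicit Defensive.

Local Open Scope classical_set_scope.
Local Open Scope group_scope.

Record Sym (S : Type) := MkSym {
  sym_fun :> S -> S;
  sym_bij : bijective sym_fun }.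

Arguments MkSym {S}.

Lemma symP (S : Type) (f g : Sym S) : f =1 g -> f = g.
Proof.
case: f g => [f bf] [g bg] /= /funext fg; case: _ / fg in bg *.
by rewrite (Prop_irrelevance bf bg).
Qed.

Section SymGroup.
Variable S : Type.
Implicit Types f g h : Sym S.

Definition sym_one : Sym S := MkSym id (inv_bij (frefl id)).

(* Permutations act on the left: (f * g) x = f (g x), unlike MathComp's
   {perm T}. *)
Definition sym_mul f g : Sym S :=
  MkSym (f \o g) (bij_comp (sym_bij f) (sym_bij g)).

Lemma sym_has_inv f : exists g : Sym S, cancel f g /\ cancel g f.
Proof.
by case: (sym_bij f) => g fK gK; exists (MkSym g (Bijective gK fK)).
Qed.

Definition sym_inv f : Sym S := projT1 (cid (sym_has_inv f)).

Lemma sym_mulA : associative sym_mul.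
Proof. by move=> f g h; apply: symP. Qed.

Lemma sym_mul1 : left_id sym_one sym_mul.
Proof. by move=> f; apply: symP. Qed.

Lemma sym_mulr1 : right_id sym_one sym_mul.
Proof. by move=> f; apply: symP. Qed.

Lemma sym_mulV : left_inverse sym_one sym_inv sym_mul.
Proof.
by move=> f; apply: symP => x /=; rewrite /sym_inv; case: cid => g [/= fK _].
Qed.

Lemma sym_mulrV : right_inverse sym_one sym_inv sym_mul.
Proof.
by move=> f; apply: symP => x /=; rewrite /sym_inv; case: cid => g [/= _ gK].
Qed.

End SymGroup.

HB.instance Definition _ (S : Type) := gen_eqMixin (Sym S).
HB.instance Definition _ (S : Type) := gen_choiceMixin (Sym S).
HB.instance Definition _ (S : Type) := isGroup.Build (Sym S)
  (@sym_mulA S) (@sym_mul1 S) (@sym_mulr1 S) (@sym_mulV S) (@sym_mulrV S).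

Definition is_subgroup (gT : groupType) (G : set gT) : Prop :=
  group_closed (mem G).

Definition subgroup_of (gT : groupType) (K G : set gT) : Prop :=
  is_subgroup K /\ K `<=` G.

Definition centralizer (gT : groupType) (G : set gT) : set gT :=
  [set h | forall g, G g -> commute h g].

(* The permutations in K preserve the nonempty set A, and the resulting action
   of K on A is simply transitive. *)
Definition simply_transitive (S : Type) (K : set (Sym S)) (A : set S) : Prop :=
  [/\ A !=set0,
      forall g : Sym S, K g -> set_fun A A g
    & forall x y, A x -> A y -> exists! g : Sym S, K g /\ g x = y].

Definition dual_groups (S : Type) (G H : set (Sym S)) : Prop :=
  [/\ is_subgroup G /\ is_subgroup H,
      simply_transitive G [set: S], simply_transitive H [set: S],
      centralizer G = H & centralizer H = G].

Definition orbit_of (S : Type) (K : set (Sym S)) (s : S) : set S :=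
  [set g s | g in K].

Section Restriction.
Variables (S : Type) (A : set S).

Definition restr_fun (g : Sym S) (gA : set_bij A A g) (x : A) : A :=
  let: And3 gAA _ _ := gA in
  exist _ (g (sval x)) (mem_set (gAA _ (set_mem (svalP x)))).

Lemma restr_funE (g : Sym S) (gA : set_bij A A g) x : sval (restr_fun gA x) = g (sval x).
Proof. by rewrite /restr_fun; case: gA. Qed.

Lemma restr_fun_bij (g : Sym S) (gA : set_bij A A g) : bijective (restr_fun gA).
Proof.
have inj : injective (restr_fun gA).
  move=> x y /(congr1 sval); rewrite !restr_funE => /(bij_inj (sym_bij g)).
  exact: val_inj.
have surj y : {x | restr_fun gA x = y}.
  apply: cid; have [_ _ /(_ _ (set_mem (svalP y)))[x Ax gx]] := gA.
  by exists (exist _ x (mem_set Ax)); apply: val_inj; rewrite /= restr_funE.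
exists (fun y => sval (surj y)) => y; last exact: svalP (surj y).
by apply: inj; rewrite (svalP (surj _)).
Qed.

(* g|_A, as a permutation of A; the value 1 when g(A) != A is junk. *)
Definition restr (g : Sym S) : Sym A :=
  if pselect (set_bij A A g) is left gA then MkSym _ (restr_fun_bij gA) else 1.

(* g|_A is a genuine restriction for every g in K, and g |-> g|_A is an
   injective group homomorphism from K to Sym(A). *)
Definition restriction_embeds (K : set (Sym S)) : Prop :=
  [/\ forall g : Sym S, K g -> set_bij A A g,
      forall g : Sym S, K g -> forall x : A, sval (restr g x) = g (sval x),
      {in K &, {morph restr : g h / g * h}}
    & {in K &, injective restr}].

Definition extends (g : Sym S) (g0 : Sym A) : Prop :=
  forall x : A, g (sval x) = sval (g0 x).

(* g0 has exactly one extension belonging to G, and this extension lies in K. *)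
Definition unique_extension (G K : set (Sym S)) (g0 : Sym A) : Prop :=
  exists g : Sym S, unique (fun f => G f /\ extends f g0) g /\ K g.

End Restriction.

(* Main.v *)
Require Import Defs.
From HB Require Import structures.
From mathcomp Require Import all_boot.
From mathcomp Require Import boolp classical_sets functions.

Set Implicit Arguments.
Unset Strict Implicit.

Local Open Scope classical_set_scope.
Local Open Scope group_scope.

(** Since G acts freely, an element of G moving s0 into G0 s0 lies in G0; since
  H is transitive and commutes with G, we get S0 = H0 s0 as well, so the pairs
  (G0, G) and (H0, H) play symmetric roles. A permutation c of S0 commuting
  with H0 is determined by c s0 = g s0 with g in G0: it sends h s0 to
  h (c s0) = h (g s0) = g (h s0), so it is the restriction of g. *)

Lemma is_subgroupP (gT : groupType) (G : set gT) :
  is_subgroup G <->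
  [/\ G 1, forall g h, G g -> G h -> G (g * h) & forall g, G g -> G g^-1].
Proof.
split=> [[/set_mem G1 Gdiv]|[G1 GM GV]].
  have GV g : G g -> G g^-1.
    by move=> Gg; rewrite -(mul1g g^-1); apply/set_mem/Gdiv; exact: mem_set.
  split=> // g h Gg Gh; rewrite -(invgK h).
  by apply/set_mem/Gdiv; apply: mem_set => //; exact: GV.
split; first exact: mem_set.
by move=> g h /set_mem Gg /set_mem Gh; apply/mem_set/GM => //; exact: GV.
Qed.

Lemma symK (S : Type) (g : Sym S) : cancel g (g^-1)%g.
Proof. by move=> x; rewrite -[LHS]/((g^-1 * g) x) mulVg. Qed.

Lemma symVK (S : Type) (g : Sym S) : cancel (g^-1)%g g.
Proof. by move=> x; rewrite -[LHS]/((g * g^-1) x) mulgV. Qed.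

(** Freeness is isolated from simple transitivity because it is the half that passes to subgroups:
    [G0] need not be transitive on [S]. *)
Definition acts_freely (S : Type) (G : set (Sym S)) : Prop :=
  forall (g h : Sym S) x, G g -> G h -> g x = h x -> g = h.

Lemma simply_transitive_free (S : Type) (G : set (Sym S)) :
  simply_transitive G [set: S] -> acts_freely G.
Proof.
move=> [_ _ trG] g h x Gg Gh gxhx.
(* Both [g] and [h] equal the unique element carrying [x] to [g x]. *)
have [k [_ kU]] := trG x (g x) I I.
by rewrite -(kU g) // -(kU h).
Qed.

Section OrbitOfSubgroup.
Variables (S : Type) (G K : set (Sym S)) (s : S).
Hypotheses (freeG : acts_freely G) (subK : subgroup_of K G).

Lemma orbit_id : orbit_of K s s.
Proof. by case: subK => /is_subgroupP[K1 _ _] _; exists 1. Qed.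

Lemma orbit_stable (g : Sym S) x : K g -> orbit_of K s x -> orbit_of K s (g x).
Proof.
by case: subK => /is_subgroupP[_ KM _] _ Kg [h Kh <-]; exists (g * h) => //; exact: KM.
Qed.

Lemma orbit_simply_transitive : simply_transitive K (orbit_of K s).
Proof.
case: (subK) => /is_subgroupP[_ KM KV] KG; split.
- by exists s; exact: orbit_id.
- by move=> g Kg x; exact: orbit_stable.
move=> _ _ [a Ka <-] [b Kb <-].
(* Existence: [b * a^-1] carries [a s] to [b s], through [s]. Uniqueness comes from freeness of
   [G]. *)
have Kba : K (b * a^-1) by apply: KM => //; exact: KV.
have baE : (b * a^-1) (a s) = b s by rewrite /= -[X in b X]/(a^-1 (a s)) symK.
exists (b * a^-1); split=> // g [Kg gE].
by apply: (@freeG _ _ (a s)); [exact: KG|exact: KG|rewrite gE].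
Qed.

Lemma mem_of_orbit (g : Sym S) : G g -> orbit_of K s (g s) -> K g.
Proof.
by case: subK => _ KG Gg [k Kk ks]; rewrite (@freeG g k s) //; exact: KG.
Qed.

Lemma orbit_set_bij (g : Sym S) : K g -> set_bij (orbit_of K s) (orbit_of K s) g.
Proof.
case: (subK) => /is_subgroupP[_ _ KV] _ Kg; split.
- by move=> x; exact: orbit_stable.
- by move=> x y _ _; exact: (can_inj (symK g)).
move=> y Sy; exists (g^-1 y); last exact: symVK.
by apply: orbit_stable => //; exact: KV.
Qed.

(** Elements of [K] permute the orbit, so the junk branch of [restr] never occurs here. The later
    facts on restrictions rest on this equation. *)
Lemma restr_orbitE (g : Sym S) (x : orbit_of K s) :
  K g -> sval (restr (orbit_of K s) g x) = g (sval x).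
Proof.
move=> /orbit_set_bij gA; rewrite /restr.
by case: pselect => // gA'; exact: restr_funE.
Qed.

Lemma restr_orbit_inj (g h : Sym S) :
  K g -> K h -> restr (orbit_of K s) g = restr (orbit_of K s) h -> g = h.
Proof.
case: (subK) => _ KG Kg Kh gh.
(* Comparing the two restrictions at the base point [s] suffices, by freeness. *)
have := congr1 (fun c : Sym (orbit_of K s) =>
  sval (c (exist _ s (mem_set orbit_id)))) gh.
by rewrite !restr_orbitE //=; apply: freeG; exact: KG.
Qed.

Lemma restr_orbitM (g h : Sym S) : K g -> K h ->
  restr (orbit_of K s) (g * h) = restr (orbit_of K s) g * restr (orbit_of K s) h.
Proof.
case: (subK) => /is_subgroupP[_ KM _] _ Kg Kh.
apply: symP => x; apply: val_inj.
rewrite [LHS]restr_orbitE; last exact: KM.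
rewrite -[RHS]/(sval (restr _ g (restr _ h x))).
by rewrite !restr_orbitE.
Qed.

Lemma orbit_restriction_embeds : restriction_embeds (orbit_of K s) K.
Proof.
split.
- exact: orbit_set_bij.
- by move=> g Kg x; exact: restr_orbitE.
- by move=> g h /set_mem Kg /set_mem Kh; exact: restr_orbitM.
- by move=> g h /set_mem Kg /set_mem Kh; exact: restr_orbit_inj.
Qed.

Lemma restr_orbit1 : restr (orbit_of K s) 1 = 1.
Proof.
case: (subK) => /is_subgroupP[K1 _ _] _.
by apply: symP => x; apply: val_inj; rewrite [LHS]restr_orbitE.
Qed.

Lemma restr_orbit_subgroup : is_subgroup [set restr (orbit_of K s) g | g in K].
Proof.
case: (subK) => /is_subgroupP[K1 KM KV] _; apply/is_subgroupP; split.
- by exists 1 => //; exact: restr_orbit1.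
- move=> _ _ [g Kg <-] [h Kh <-]; exists (g * h); first exact: KM.
  exact: restr_orbitM.
- move=> _ [g Kg <-]; exists g^-1; first exact: KV.
  (* Multiplicativity gives the restricted inverse, after left cancellation of the restriction of
     [g]. *)
  apply: (mulgI (restr (orbit_of K s) g)); rewrite mulgV -restr_orbitM ?mulgV //.
    exact: restr_orbit1.
  exact: KV.
Qed.

Lemma restr_orbit_simply_transitive :
  simply_transitive [set restr (orbit_of K s) g | g in K] [set: orbit_of K s].
Proof.
have [_ _ trK] := orbit_simply_transitive; split=> //.
  by exists (exist _ s (mem_set orbit_id)).
move=> x y _ _.
have [g [[Kg gxy] gU]] := trK _ _ (set_mem (svalP x)) (set_mem (svalP y)).
exists (restr _ g); split.
  by split; [exists g|apply: val_inj; rewrite [LHS]restr_orbitE].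
move=> _ [[h Kh <-] hxy]; congr restr; apply: gU; split=> //.
by rewrite -hxy restr_orbitE.
Qed.

End OrbitOfSubgroup.

Section CommutingSubgroups.
Variables (S : Type) (G H K L : set (Sym S)) (s : S) (A : set S).
Hypotheses (freeG : acts_freely G) (GH : forall g h, G g -> H h -> commute g h).
Hypotheses (subK : subgroup_of K G) (subL : subgroup_of L H).
(** The type [Sym A] depends on [A], and the two orbits are only provably equal. Keeping [A] a
    variable with two equations lets the pairs ([K], [G]) and ([L], [H]) exchange roles. *)
Hypotheses (AK : A = orbit_of K s) (AL : A = orbit_of L s).

Lemma commuting_unique_extension (c : Sym A) :
  (forall d, [set restr A h | h in L] d -> commute c d) ->
  unique_extension G K c.
Proof.
move=> cL; have As : A s by rewrite AK; exact: orbit_id subK.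
pose s' : A := exist _ s (mem_set As).
have : A (sval (c s')) := set_mem (svalP (c s')).
rewrite {1}AK => -[g Kg gs]; have [_ KG] := subK; have [_ LH] := subL.
have gc : extends g c.
  move=> x; have : A (sval x) := set_mem (svalP x).
  (* As [A] is also the [L]-orbit, [x] is [h s]; commuting [c] past [h] reduces the claim to the
     base point, where [g] agrees with [c] by choice. *)
  rewrite {1}AL => -[h Lh hs].
  have rE y : sval (restr A h y) = h (sval y).
    by move: y; rewrite AL => y; exact: (restr_orbitE subL y Lh).
  have -> : x = restr A h s' by apply: val_inj; rewrite [RHS]rE.
  have : commute c (restr A h) by apply: cL; exists h.
  move=> /(congr1 (fun d : Sym A => sval (d s'))) /= ->; rewrite !rE -gs.
  exact: (congr1 (fun d : Sym S => d s) (GH (KG _ Kg) (LH _ Lh))).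
exists g; split=> //; split; first by split=> //; exact: KG.
(* Every extension of [c] has the same value at [s], so freeness leaves only one in [G]. *)
move=> g' [Gg' g'c]; apply: (@freeG _ _ s) => //; first exact: KG.
by rewrite (gc s') (g'c s').
Qed.

Lemma centralizer_restr :
  centralizer [set restr A h | h in L] = [set restr A g | g in K].
Proof.
have [_ KG] := subK; have [_ LH] := subL.
have rK g x : K g -> sval (restr A g x) = g (sval x).
  by move: x; rewrite AK => x; exact: (restr_orbitE subK x).
have rL h x : L h -> sval (restr A h x) = h (sval x).
  by move: x; rewrite AL => x; exact: (restr_orbitE subL x).
apply/seteqP; split=> c.
  (* A permutation centralizing the restrictions of [L] extends to some [g] in [K], hence is the
     restriction of that [g]. *)
  move=> /commuting_unique_extension[g [[[_ gc] _] Kg]]; exists g => //.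
  by apply: symP => x; apply: val_inj; rewrite [LHS]rK.
move=> [g Kg <-] _ [h Lh <-]; apply: symP => x; apply: val_inj.
rewrite /= [LHS]rK // [RHS]rL // [in LHS]rL // [in RHS]rK //.
exact: (congr1 (fun d : Sym S => d (sval x)) (GH (KG _ Kg) (LH _ Lh))).
Qed.

End CommutingSubgroups.

Section DualOrbit.
Variables (S : Type) (G H K : set (Sym S)) (s : S).
Hypotheses (subH : is_subgroup H) (trH : simply_transitive H [set: S]).
Hypotheses (GH : forall g h, G g -> H h -> commute g h).
Hypothesis (subK : subgroup_of K G).

Let L : set (Sym S) := [set h | H h /\ orbit_of K s (h s)].

Lemma dual_stabilizer_subgroup : subgroup_of L H.
Proof.
have [/is_subgroupP[K1 KM KV] KG] := subK.
have /is_subgroupP[H1 HM HV] := subH.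
have swap g h x : K g -> H h -> g (h x) = h (g x).
  by move=> Kg Hh; exact: (congr1 (fun d : Sym S => d x) (GH (KG _ Kg) Hh)).
split; last by move=> h [].
apply/is_subgroupP; split.
- by split=> //; exact: orbit_id subK.
- move=> h h' [Hh [g Kg gs]] [Hh' [g' Kg' gs']]; split; first exact: HM.
  (* The order reverses: with [h s = g s] and [h' s = g' s], one has [h (h' s) = h (g' s) = g' (h s)
     = g' (g s)]. *)
  exists (g' * g); first exact: KM.
  by rewrite /= -[RHS]/(h (h' s)) -gs' -(swap g' h) // -gs.
- move=> h [Hh [g Kg gs]]; split; first exact: HV.
  exists g^-1; first exact: KV.
  (* To see [g^-1 s = h^-1 s], apply [h]: [h (g^-1 s) = g^-1 (h s) = g^-1 (g s) = s]. *)
  apply: (can_inj (symK h)); rewrite symVK -(swap g^-1 h) //; last exact: KV.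
  by rewrite -gs symK.
Qed.

Lemma orbit_dual_stabilizer : orbit_of K s = orbit_of L s.
Proof.
apply/seteqP; split=> x; last by move=> [h [_ ?] <-].
(* Transitivity of [H] yields [h] with [h s = x]; it lies in [L] precisely because [x] is in the
   [K]-orbit. *)
move=> Sx; have [_ _ /(_ s x I I)[h [[Hh hx] _]]] := trH.
by exists h => //; split=> //; rewrite hx.
Qed.

End DualOrbit.

Unset Implicit Arguments.

Theorem theorem3p1 (S : Type) (G H : set (Sym S)) (dualGH : dual_groups G H)
    (G0 : set (Sym S)) (subG0 : subgroup_of G0 G) (s0 : S) :
  let S0 : set S := orbit_of G0 s0 in
  let H0 : set (Sym S) := [set h | H h /\ S0 (h s0)] in
  let G0r : set (Sym S0) := [set restr S0 g | g in G0] in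
  let H0r : set (Sym S0) := [set restr S0 h | h in H0] in
  [/\ simply_transitive G0 S0,
      forall g : Sym S, G g -> S0 (g s0) -> G0 g /\ [set g x | x in S0] `<=` S0,
      subgroup_of H0 H /\ simply_transitive H0 S0,
      restriction_embeds S0 G0 /\ restriction_embeds S0 H0
    & [/\ forall g : Sym S0, (forall h, H0r h -> commute g h) ->
            unique_extension G G0 g,
          forall h : Sym S0, (forall g, G0r g -> commute h g) ->
            unique_extension H H0 h
        & dual_groups G0r H0r]].
Proof.
move=> S0 H0 G0r H0r.
have [[sG sH] trG trH cG _] := dualGH.
have freeG := simply_transitive_free trG.
have freeH := simply_transitive_free trH.
have HG h g : H h -> G g -> commute h g by rewrite -cG => Hh; exact: Hh.
have GH g h : G g -> H h -> commute g h by move=> Gg Hh; exact/esym/HG.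
have subH0 : subgroup_of H0 H := dual_stabilizer_subgroup s0 sH GH subG0.
(* Reading [S0] as an [H0]-orbit makes the results on orbits of subgroups available for [H0] as
   well. *)
have S0E : S0 = orbit_of H0 s0 := orbit_dual_stabilizer G0 s0 trH.
split.
- exact: orbit_simply_transitive freeG subG0.
- move=> g Gg Sg; have G0g := mem_of_orbit freeG subG0 Gg Sg.
  by split=> // _ [x Sx <-]; exact: (orbit_stable subG0 G0g Sx).
- by split=> //; rewrite S0E; exact: orbit_simply_transitive freeH subH0.
- split; first exact: orbit_restriction_embeds freeG subG0.
  by rewrite S0E; exact: orbit_restriction_embeds freeH subH0.
split.
- move=> g; exact: commuting_unique_extension freeG GH subG0 subH0 erefl S0E _.
- move=> h; exact: commuting_unique_extension freeH HG subH0 subG0 S0E erefl _.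
split.
- split; first exact: restr_orbit_subgroup subG0.
  by rewrite /H0r S0E; exact: restr_orbit_subgroup subH0.
- exact: restr_orbit_simply_transitive freeG subG0.
- by rewrite /H0r S0E; exact: restr_orbit_simply_transitive freeH subH0.
(* Here ([H], [H0]) takes the place of ([G], [G0]), which gives the centralizer of [G0r]. *)
- exact: centralizer_restr freeH HG subH0 subG0 S0E erefl.
- exact: centralizer_restr freeG GH subG0 subH0 erefl S0E.
Qed.
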